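(* Suppose $\Omega$ is a compact metrizable topological group and $\alpha\in\Omega$ generates a dense cyclic subgroup (so $\Omega$ is abelian; it is written additively). Let $R_\alpha:\Omega\to\Omega$, $R_\alpha\omega=\alpha+\omega$, let $\widehat\Omega$ be the dual group, let $\widehat\varphi_\alpha:\widehat\Omega\to\mathbb T$ be the homomorphism $\widehat\varphi_\alpha(\chi)=\chi(\alpha)$, and let $\pi:\mathbb R\to\mathbb T$ be the canonical projection. Then $$\mathfrak A(\Omega,R_\alpha)=\pi^{-1}\bigl(\widehat\varphi_\alpha(\widehat\Omega)\bigr).$$ In particular, if $V:\mathbb Z\to\mathbb R$ is almost-periodic, $\Omega=\operatorname{hull}(V)$, and $T:\Omega\to\Omega$ denotes the shift $[T\omega](n)=\omega(n+1)$, then $$\mathfrak A(\Omega,T)=\mathfrak M(V),$$ where $\mathfrak M(V)$ is the frequency module of $V$.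
   Context: $\mathbb T=\mathbb R/\mathbb Z$. For a compact abelian group $G$, the dual group $\widehat G$ is the group of characters, i.e. continuous homomorphisms $\chi:G\to\mathbb T$. If $\alpha$ generates a dense subgroup of $\Omega$, then $(\Omega,R_\alpha)$ is uniquely ergodic with invariant measure normalized Haar measure. Almost-periodicity: let $[SV](n)=V(n+1)$ for $V\in\ell^\infty(\mathbb Z)$. $\operatorname{orb}(V)=\{S^kV:k\in\mathbb Z\}$, and $\operatorname{hull}(V)$ is its closure in $\ell^\infty(\mathbb Z)$. $V$ is almost-periodic if $\operatorname{hull}(V)$ is compact in $\ell^\infty(\mathbb Z)$. In that case the operation $S^kV\circledast S^\ell V=S^{k+\ell}V$ on $\operatorname{orb}(V)$ extends uniquely to a continuous operation on $\operatorname{hull}(V)$, making it a compact abelian group with identity $V$ and dense cyclic subgroup $\operatorname{orb}(V)$ generated by $SV$. The frequency module is $\mathfrak M(V)=\{t\in\mathbb R:\pi(t)=\chi(SV)\text{ for some }\chi\in\widehat{\operatorname{hull}(V)}\}$. For a compact metric space $\Omega$, homeomorphism $T:\Omega\to\Omega$ and $T$-ergodic Borel probability measure $\mu$: the suspension is $X=(\Omega\times\mathbb R)/\!\sim$, where $(\omega,t)\sim(\omega',t')$ iff $(\omega',t')=(T^n\omega,t-n)$ for some $n\in\mathbb Z$, with classes $[\omega,t]$, flow $\overline T^{t}[\omega,s]=[\omega,s+t]$, and $\overline T$-ergodic measure $\overline\mu$ given by $\int_X g\,d\overline\mu=\int_0^1\int_\Omega g[\omega,s]\,d\mu(\omega)\,ds$.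 $C^\sharp(X,\mathbb T)$ is the group of homotopy classes of continuous maps $X\to\mathbb T$ (pointwise addition). For $\phi\in C(X,\mathbb T)$, $x\in X$, let $\widetilde\phi_x:\mathbb R\to\mathbb R$ be a continuous lift of $t\mapsto\phi(\overline T^{t}x)$. For $\overline\mu$-a.e. $x$, $\lim_{t\to\infty}\widetilde\phi_x(t)/t$ exists and equals a constant depending only on $[\phi]$, denoted $\mathfrak A_{\overline\mu}([\phi])$ (the Schwartzman homomorphism). $\mathfrak A(\Omega,T,\mu)=\mathfrak A_{\overline\mu}(C^\sharp(X,\mathbb T))\subseteq\mathbb R$ is its range; when $(\Omega,T)$ is uniquely ergodic one writes $\mathfrak A(\Omega,T)$. *)

(* Defs.v *)
From HB Require Import structures.
From mathcomp Require Import all_boot all_order all_algebra.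
From mathcomp Require Import generic_quotient ring_quotient zify lra.
From mathcomp Require Import all_classical all_reals all_analysis.

Set Implicit Arguments.
Unset Strict Implicit.
Unset Printing Implicit Defensive.

Import Order.TTheory GRing.Theory Num.Theory.
Import numFieldNormedType.Exports.

Local Open Scope classical_set_scope.
Local Open Scope ring_scope.
Local Open Scope quotient_scope.

Section Circle.
Variable R : realType.

Definition int_subgroup : zmodClosed R :=
  GRing.ZmodClosed.clone R (@Num.int_num_subdef R) _.

(* T = R/Z, with its quotient group structure and its quotient topology. *)
Definition circle : Type := Quotient.quot int_subgroup.

HB.instance Definition _ :=
  GRing.Zmodule.copy circle (Quotient.quot int_subgroup).
HB.instance Definition _ := Quotient.copy circle (Quotient.quot int_subgroup).

Definition circle_pi (t : R) : circle := \pi_circle t.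

Definition circle_open (U : set circle) := open (circle_pi @^-1` U).

Lemma circle_openT : circle_open setT.
Proof. by rewrite /circle_open preimage_setT; exact: openT. Qed.

Lemma circle_openI : setI_closed circle_open.
Proof. by move=> U V oU oV; exact: openI. Qed.

Lemma circle_open_bigU (I : Type) (f : I -> set circle) :
  (forall i, circle_open (f i)) -> circle_open (\bigcup_i f i).
Proof. by move=> fo; apply: bigcup_open => i _; exact: fo. Qed.

HB.instance Definition _ :=
  isOpenTopological.Build circle circle_openT circle_openI circle_open_bigU.

Lemma circle_pi_eq (s t : R) : circle_pi s = circle_pi t <->
  s - t \is a Num.int.
Proof.
have E := Quotient.idealrBE int_subgroup s t.
split=> [/eqP st|st]; last by apply/eqP; rewrite -E.
by rewrite -[_ \is a _]/(_ \in int_subgroup) E.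
Qed.

Lemma circle_piD : {morph circle_pi : s t / s + t}.
Proof. exact: (Quotient.pi_add int_subgroup). Qed.

End Circle.

Definition metrizable (R : realType) (X : topologicalType) :=
  exists d : X -> X -> R,
    [/\ forall x y, 0 <= d x y,
        forall x y, d x y = 0 <-> x = y,
        forall x y, d x y = d y x,
        forall x y z, d x z <= d x y + d y z &
        forall x (U : set X),
          nbhs x U <-> exists2 e, 0 < e & [set y | d x y < e] `<=` U].

(* The continuous characters of a topological group whose law is [mul]. *)
Definition dual_group (R : realType) (G : topologicalType) (mul : G -> G -> G) :
    set (G -> circle R) :=
  [set chi | continuous chi /\ forall x y, chi (mul x y) = chi x + chi y].
Arguments dual_group R {G} mul.

Section Homeomorphism.
Variable X : topologicalType.

Structure homeomorphism := Homeomorphism {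
  homeo_fun :> X -> X;
  homeo_inv : X -> X;
  homeo_funK : cancel homeo_fun homeo_inv;
  homeo_invK : cancel homeo_inv homeo_fun;
  homeo_fun_continuous : continuous homeo_fun;
  homeo_inv_continuous : continuous homeo_inv }.

Variable T : homeomorphism.

(* T^n for n : int. *)
Definition ziter (n : int) : X -> X :=
  match n with
  | Posz m => iter m T
  | Negz m => iter m.+1 (homeo_inv T)
  end.

Lemma ziterS n x : ziter (n + 1) x = T (ziter n x).
Proof.
case: n => [m|[|m]].
- by rewrite (_ : Posz m + 1 = Posz m.+1) //; lia.
- by rewrite /= homeo_invK.
- rewrite (_ : Negz m.+1 + 1 = Negz m); last lia.
  by rewrite /= homeo_invK.
Qed.

Lemma ziterP n x : ziter (n - 1) x = homeo_inv T (ziter n x).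
Proof. by rewrite -[in RHS](subrK 1 n) ziterS homeo_funK. Qed.

Lemma ziterD m n x : ziter (m + n) x = ziter m (ziter n x).
Proof.
elim/int_rect: m => [|m IH|m IH]; first by rewrite add0r.
  by rewrite -addn1 PoszD addrAC !ziterS IH.
by rewrite -addn1 PoszD opprD addrAC !ziterP IH.
Qed.

End Homeomorphism.

(* The Borel sigma-algebra of [X]. Measurable types are pointed in the library,
   hence the parameter [x0], which plays no other role. *)
Definition based (X : Type) (x0 : X) : Type := X.
HB.instance Definition _ (X : choiceType) (x0 : X) := Choice.on (based x0).
HB.instance Definition _ (X : choiceType) (x0 : X) :=
  isPointed.Build (based x0) x0.

Definition borel (X : topologicalType) (x0 : X) : Type :=
  g_sigma_algebraType (@open X : set (set (based x0))).
HB.instance Definition _ (X : topologicalType) (x0 : X) :=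
  Measurable.on (borel x0).

Section Ergodic.
Variables (R : realType) (X : topologicalType) (x0 : X).
Variables (T : X -> X) (mu : probability (borel x0) R).

Definition measure_preserving :=
  forall A : set (borel x0), measurable A -> mu (T @^-1` A) = mu A.

Definition ergodic :=
  measure_preserving /\
  forall A : set (borel x0), measurable A -> T @^-1` A = A ->
    mu A = 0%E \/ mu A = 1%E.

End Ergodic.

Section Homotopy.
Variables (R : realType) (X Y : topologicalType).

Definition homotopic (f g : continuousType X Y) : bool :=
  `[< exists h : X * R -> Y,
        [/\ {within [set: X] `*` `[0, 1], continuous h},
            forall x, h (x, 0) = f x & forall x, h (x, 1) = g x] >].

Lemma homotopic_refl : reflexive homotopic.
Proof.
move=> f; apply/asboolP; exists (f \o fst); split => //.
apply: continuous_subspaceT => z; apply: continuous_comp; first exact: cvg_fst.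
exact: cts_fun.
Qed.

Lemma pair_continuous (A B C : topologicalType) (f : A -> B) (g : A -> C) :
  continuous f -> continuous g -> continuous (fun z => (f z, g z)).
Proof.
move=> cf cg z; apply: (@cvg_pair _ _ _ _ (nbhs (f z)) (nbhs (g z))).
  exact: cf.
exact: cg.
Qed.

Lemma within_comp_continuous (Z W : topologicalType) (A : set Z) (B : set W)
    (h : Z -> Y) (s : W -> Z) :
  {within A, continuous h} -> continuous s -> B `<=` s @^-1` A ->
  {within B, continuous (h \o s)}.
Proof.
move=> /subspace_continuousP ch cs BA; apply/subspace_continuousP => x Bx U hU.
have := cs x _ (ch _ (BA _ Bx) _ hU); rewrite /nbhs /= /within /=.
by apply: filterS => y + By => /(_ (BA _ By)).
Qed.

Lemma homotopic_sym : symmetric homotopic.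
Proof.
have H f g : homotopic f g -> homotopic g f.
  move=> /asboolP[h [ch h0 h1]]; apply/asboolP.
  exists (fun z => h (z.1, 1 - z.2)); split=> [|x|x] /=.
  - apply: within_comp_continuous ch _ _ => [|[x t] [_ /=]].
      apply: pair_continuous => z; first exact: cvg_fst.
      by apply: cvgB; [exact: cvg_cst|exact: cvg_snd].
    by rewrite !in_itv/= => ?; split => //; lra.
  - by rewrite subr0.
  - by rewrite subrr.
by move=> f g; apply/idP/idP; exact: H.
Qed.

Lemma homotopic_trans : transitive homotopic.
Proof.
move=> g f k /asboolP[h [ch h0 h1]] /asboolP[h' [ch' h'0 h'1]]; apply/asboolP.
exists (fun z => if z.2 <= 2^-1 then h (z.1, 2 * z.2)
                 else h' (z.1, 2 * z.2 - 1)).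
split=> [|x|x] /=; last 2 first.
- by rewrite invr_ge0 ler0n mulr0.
- rewrite ifF; last by apply/negbTE; rewrite -ltNge; lra.
  by rewrite (_ : 2 * 1 - 1 = 1) ?h'1//; lra.
have cl (a b : R) : closed ([set: X] `*` `[a, b]).
  rewrite (_ : _ `*` _ = (snd : X * R -> R) @^-1` `[a, b]); last first.
    by apply/seteqP; split=> [z []|z].
  apply: preimage_closed; last exact: interval_closed.
  by move=> z _; exact: cvg_snd.
rewrite (_ : _ `*` _ = ([set: X] `*` `[0, 2^-1]) `|` ([set: X] `*` `[2^-1, 1])).
  apply: withinU_continuous.
  - exact: cl.
  - exact: cl.
  - apply: (@subspace_eq_continuous _ _ _ (h \o (fun z => (z.1, 2 * z.2)))).
      move=> [x t]; rewrite inE /= in_itv/= => -[_ /andP[_ t2]].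
      by rewrite /from_subspace /= t2.
    apply: within_comp_continuous ch _ _ => [|[x t] [_ /=]].
      apply: pair_continuous => z; first exact: cvg_fst.
      by apply: cvgM; [exact: cvg_cst|exact: cvg_snd].
    by rewrite !in_itv/= => ?; split => //; lra.
  - apply: (@subspace_eq_continuous _ _ _ (h' \o (fun z => (z.1, 2 * z.2 - 1)))).
      move=> [x t]; rewrite inE /= in_itv/= => -[_ /andP[t2 _]].
      rewrite /from_subspace /=; case: ifPn => //= t2'.
      have -> : t = 2^-1 by lra.
      by rewrite divff// subrr h1 h'0.
    apply: within_comp_continuous ch' _ _ => [|[x t] [_ /=]].
      apply: pair_continuous => z; first exact: cvg_fst.
      apply: cvgB; last exact: cvg_cst.
      by apply: cvgM; [exact: cvg_cst|exact: cvg_snd].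
    by rewrite !in_itv/= => ?; split => //; lra.
apply/seteqP; split=> -[x t] /=; rewrite !in_itv/=.
  by move=> [_ ?]; have [?|?] := leP t 2^-1; [left|right]; split => //; lra.
by move=> [|] [_ ?]; split => //; lra.
Qed.

Definition homotopy_equiv :=
  EquivRel homotopic homotopic_refl homotopic_sym homotopic_trans.

Definition homotopy_class : Type := {eq_quot homotopy_equiv}.
HB.instance Definition _ := Quotient.on homotopy_class.

End Homotopy.

Section Suspension.
Variables (R : realType) (X : topologicalType) (T : homeomorphism X).

Definition susp_rel (p q : X * R) : bool :=
  `[< exists n : int, q = (ziter T n p.1, p.2 - n%:~R) >].

Lemma susp_rel_refl : reflexive susp_rel.
Proof. by move=> [x t]; apply/asboolP; exists 0; rewrite subr0. Qed.

Lemma susp_rel_sym : symmetric susp_rel.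
Proof.
have H p q : susp_rel p q -> susp_rel q p.
  move=> /asboolP[n ->]; apply/asboolP; exists (- n).
  by rewrite /= -ziterD addNr rmorphN opprK subrK; case: p.
by move=> p q; apply/idP/idP; exact: H.
Qed.

Lemma susp_rel_trans : transitive susp_rel.
Proof.
move=> q p r /asboolP[m ->] /asboolP[n ->]; apply/asboolP; exists (n + m).
by rewrite /= ziterD rmorphD opprD addrA addrAC.
Qed.

Definition susp_equiv :=
  EquivRel susp_rel susp_rel_refl susp_rel_sym susp_rel_trans.

Definition suspension : Type := quotient_topology {eq_quot susp_equiv}.

HB.instance Definition _ := Topological.on suspension.
HB.instance Definition _ := Quotient.on suspension.

Definition susp_class (x : X) (s : R) : suspension :=
  \pi_{eq_quot susp_equiv} (x, s).

Definition susp_flow (t : R) (x : suspension) : suspension :=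
  susp_class (repr x).1 ((repr x).2 + t).

Lemma susp_flowE t x s : susp_flow t (susp_class x s) = susp_class x (s + t).
Proof.
rewrite /susp_flow /susp_class.
set p := repr _.
have : p = (x, s) %[mod {eq_quot susp_equiv}] by rewrite /p reprK.
move=> /eqmodP /asboolP[n [-> ->]]; apply/eqmodP/asboolP; exists n => /=.
by rewrite addrAC.
Qed.

Variables (x0 : X) (mu : probability (borel x0) R).

(* The formula defining the integral of [g] against the suspended measure, for
   [g] the indicator function of [A]. *)
Definition susp_measure (A : set (borel (susp_class x0 0))) : \bar R :=
  (\int[lebesgue_measure]_(s in `[0%R, 1%R])
    \int[mu]_x (\1_A (susp_class x s))%:E)%E.

Definition is_lift (phi : suspension -> circle R) (x : suspension)
    (f : R -> R) :=
  continuous f /\ forall t, circle_pi (f t) = phi (susp_flow t x).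

Definition Csharp : Type := homotopy_class R suspension (circle R).

(* The Schwartzman homomorphism: the constant [a] such that, for every
   representative [phi] of [c] and almost every [x], the lifts of
   [t |-> phi (susp_flow t x)] have asymptotic slope [a]. *)
Definition schwartzman (c : Csharp) : R :=
  xget 0 [set a : R | forall phi : continuousType suspension (circle R),
    \pi_(homotopy_class R suspension (circle R)) phi = c ->
    \forall x \ae susp_measure,
      exists2 f, is_lift phi x f & f t / t @[t --> +oo] --> a].

Definition schwartzman_range : set R := range schwartzman.

End Suspension.

Section Rotation.
Variable G : topologicalZmodType.

Lemma addl_continuous (a : G) : continuous (fun x : G => a + x).
Proof.
move=> x; apply: (@continuous_comp _ _ _ (fun x => (a, x)) (fun z => z.1 + z.2)).
  by apply: cvg_pair => /=; [exact: cvg_cst|exact: cvg_id].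
exact: add_continuous.
Qed.

Definition rotation (a : G) : homeomorphism G :=
  @Homeomorphism G (fun x => a + x) (fun x => - a + x)
    (addKr a) (addNKr a) (@addl_continuous a) (@addl_continuous (- a)).

End Rotation.

Section AlmostPeriodic.
Variable R : realType.

Definition shift (k : int) (V : int -> R) : int -> R := fun n => V (n + k).

Definition orb (V : int -> R) : set {uniform int -> R} :=
  [set shift k V | k in [set: int]].

(* [{uniform int -> R}] is the space of all functions with the topology of
   uniform convergence; the subspace of bounded functions is l^oo(Z), and it is
   closed, so that the closure below is the closure in l^oo(Z) when [V] is
   bounded. *)
Definition hull (V : int -> R) : set {uniform int -> R} := closure (orb V).

Definition almost_periodic (V : int -> R) :=
  bounded_fun V /\ compact (hull V).

Variable V : int -> R.

Lemma hull_orb k : shift k V \in hull V.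
Proof. by apply/mem_set/subset_closure; exists k. Qed.

(* S^k V as a point of the hull. *)
Definition hull_pt (k : int) : hull V := exist _ (shift k V) (hull_orb k).

Lemma shiftD k l (f : int -> R) : shift k (shift l f) = shift (k + l) f.
Proof. by apply/funext => n; rewrite /shift addrA. Qed.

Lemma shift_continuous k :
  continuous (shift k : {uniform int -> R} -> {uniform int -> R}).
Proof.
move=> f P /uniform_nbhs[E [entE EP]]; apply/uniform_nbhs; exists E; split => //.
by move=> h fh; apply: EP => y _; exact: fh.
Qed.

Lemma shift_hull k f : f \in hull V -> shift k f \in hull V.
Proof.
move=> /set_mem Hf; apply/mem_set => B /shift_continuous/Hf[_ [[l _ <-] Bl]].
by exists (shift k (shift l V)); split => //; rewrite shiftD; exists (k + l).
Qed.

Definition hull_shiftz (k : int) (f : hull V) : hull V :=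
  exist _ (shift k (val f)) (shift_hull k (valP f)).

Lemma hull_shiftz_continuous k : continuous (hull_shiftz k).
Proof.
have c : continuous ((shift k : {uniform int -> R} -> {uniform int -> R})
    \o (set_val : hull V -> {uniform int -> R})).
  move=> f; apply: continuous_comp; last exact: shift_continuous.
  exact: initial_continuous.
exact: (@continuous_comp_initial (hull V) (hull V) {uniform int -> R} set_val
  (hull_shiftz k) c).
Qed.

Lemma hull_shiftzK k : cancel (hull_shiftz k) (hull_shiftz (- k)).
Proof.
by move=> f; apply: val_inj; rewrite /= shiftD addNr; apply/funext => n;
  rewrite /shift addr0.
Qed.

Definition hull_shift : homeomorphism (hull V) :=
  @Homeomorphism (hull V) (hull_shiftz 1) (hull_shiftz (- 1))
    (hull_shiftzK 1) (hull_shiftzK (- 1))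
    (@hull_shiftz_continuous 1) (@hull_shiftz_continuous (- 1)).

Definition is_hull_mul (m : hull V -> hull V -> hull V) :=
  continuous (fun p : hull V * hull V => m p.1 p.2) /\
  forall k l, m (hull_pt k) (hull_pt l) = hull_pt (k + l).

(* The group law of the hull: the unique continuous extension of
   (S^k V, S^l V) |-> S^(k+l) V, which exists when [V] is almost periodic. *)
Definition hull_mul : hull V -> hull V -> hull V :=
  xget ((fun f _ => f) : hull V -> hull V -> hull V) is_hull_mul.

Definition frequency_module : set R :=
  [set t : R | exists2 chi, dual_group R hull_mul chi &
           circle_pi t = chi (hull_pt 1)].

End AlmostPeriodic.

(* Main.v *)
(* If [chi] is a character with [chi alpha = pi t], then [w, s] |-> chi w + pi (t s)
   is a continuous map on the suspension along whose orbits every lift is affine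
   of slope t; homotopic maps have lifts at bounded distance on each orbit, because
   the suspension is compact, so the whole class has slope t.
   Conversely, let [f] be a lift of slope a along one orbit of a continuous map.
   If [n alpha] is close to 0, then f(t + n) - f(t) stays uniformly close to the
   integers, hence to a single integer, and averaging along t, t + n, t + 2n, ...
   shows that [a n] is close to that integer. Thus n alpha |-> pi (a n) is uniformly
   continuous on a dense subgroup and extends to a character.
   Both parts are instances of this argument for a compact space with a dense orbit
   [pt] on which a jointly continuous law extends [pt m, pt n |-> pt (m + n)].
   For the hull, such a law exists because every S^k is an isometry. *)

Require Import Defs.
From HB Require Import structures.
From mathcomp Require Import all_boot all_order all_algebra.
From mathcomp Require Import zify ring lra.
From mathcomp Require Import all_classical all_reals all_analysis.

Set Implicit Arguments.
Unset Strict Implicit.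
Unset Printing Implicit Defensive.

Import Order.TTheory GRing.Theory Num.Theory.
Import numFieldNormedType.Exports.

Local Open Scope classical_set_scope.
Local Open Scope ring_scope.

(** * The topology of the circle, described by translates of arcs around 0 *)

Section CircleTopology.
Variable R : realType.
Implicit Types (c d : circle R) (r s : R).

Lemma circle_pi0 : circle_pi (0 : R) = 0.
Proof. by apply: (@addrI _ (circle_pi 0)); rewrite -circle_piD !addr0. Qed.

Lemma circle_piN r : circle_pi (- r) = - circle_pi r.
Proof. by apply: (@addrI _ (circle_pi r)); rewrite -circle_piD !subrr circle_pi0. Qed.

Lemma circle_piB r s : circle_pi (r - s) = circle_pi r - circle_pi s.
Proof. by rewrite circle_piD circle_piN. Qed.

Lemma circle_piMz r (n : int) : circle_pi (r * n%:~R) = circle_pi r *~ n.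
Proof.
elim/int_rect: n => [|n IH|n IH]; first by rewrite mulr0 circle_pi0.
  by rewrite -addn1 PoszD rmorphD mulrDr mulr1 circle_piD IH mulrzDr.
by rewrite -addn1 PoszD opprD rmorphB mulrBr mulr1 circle_piB IH mulrzBr.
Qed.

Lemma circle_pi_surj c : exists r, circle_pi r = c.
Proof. by exists (repr c); rewrite /circle_pi reprK. Qed.

Lemma circle_pi_int r : r \is a Num.int -> circle_pi r = 0.
Proof. by move=> ri; rewrite -circle_pi0; apply/circle_pi_eq; rewrite subr0. Qed.

(** Plays the part of a translation-invariant metric: [circle_ball e (c - d)] says that c and d are
    at distance less than e in R/Z. *)
Definition circle_ball (e : R) : set (circle R) := [set circle_pi r | r in ball 0 e].

Lemma circle_ball_pi r (e : R) : `|r| < e -> circle_ball e (circle_pi r).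
Proof. by move=> re; exists r => //; rewrite -ball_normE /= sub0r normrN. Qed.

Lemma circle_ballP (e : R) c : circle_ball e c -> exists2 r, `|r| < e & circle_pi r = c.
Proof. by move=> [r]; rewrite -ball_normE /= sub0r normrN => re <-; exists r. Qed.

Lemma circle_ball0 (e : R) : 0 < e -> circle_ball e 0.
Proof. by move=> e0; rewrite -circle_pi0; apply: circle_ball_pi; rewrite normr0. Qed.

Lemma circle_ballD (e e' : R) c d :
  circle_ball e c -> circle_ball e' d -> circle_ball (e + e') (c + d).
Proof.
move=> /circle_ballP[r re <-] /circle_ballP[s se <-]; rewrite -circle_piD.
by apply: circle_ball_pi; rewrite (le_lt_trans (ler_normD _ _))// ltrD.
Qed.

Lemma circle_ballN (e : R) c : circle_ball e c -> circle_ball e (- c).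
Proof.
move=> /circle_ballP[r re <-]; rewrite -circle_piN.
by apply: circle_ball_pi; rewrite normrN.
Qed.

Lemma circle_ball_le (e e' : R) : e <= e' -> circle_ball e `<=` circle_ball e'.
Proof.
move=> ee' c /circle_ballP[r re <-]; apply: circle_ball_pi.
exact: lt_le_trans ee'.
Qed.

(** A non-integer r has a positive distance to both neighbouring integers. With this distance as
    radius, r would differ by an integer n from some smaller s, and n can lie neither below nor
    above r. *)
Lemma circle_ball_eq0 c : (forall e : R, 0 < e -> circle_ball e c) -> c = 0.
Proof.
have [r <-] := circle_pi_surj c => H.
have [//|ri] := boolP (r \is a Num.int); first exact: circle_pi_int.
have rf : (Num.floor r)%:~R < r.
  rewrite lt_neqAle floor_le_tmp andbT; apply: contraNneq ri => <-.
  exact: intr_int.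
have fr := floorD1_gt r.
have := H (Num.min (r - (Num.floor r)%:~R) ((Num.floor r + 1)%:~R - r)).
rewrite lt_min !subr_gt0 rf fr => /(_ isT) /circle_ballP[s].
rewrite lt_min => /andP[s1 s2] /esym/circle_pi_eq/intrP[n rsn].
have {}rsn : s = r - n%:~R by rewrite -rsn; lra.
exfalso; have [nf|nf] := leP n (Num.floor r).
  have : (n%:~R : R) <= (Num.floor r)%:~R by rewrite ler_int.
  by move: s1; rewrite rsn; case: (ger0P (r - n%:~R)); lra.
have : ((Num.floor r + 1)%:~R : R) <= n%:~R by rewrite ler_int; lia.
by move: s2; rewrite rsn; case: (ger0P (r - n%:~R)); lra.
Qed.

Lemma circle_pi_continuous : continuous (@circle_pi R).
Proof. by apply/continuousP. Qed.

Lemma nbhs_circleP c (U : set (circle R)) :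
  nbhs c U <-> exists2 e : R, 0 < e & forall d, circle_ball e d -> U (c + d).
Proof.
split.
  have [r <-] := circle_pi_surj c.
  rewrite nbhsE => -[V [oV Vr] VU].
  have /nbhs_ballP[e /= e0 eV] : nbhs r (@circle_pi R @^-1` V).
    by apply: circle_pi_continuous; apply: open_nbhs_nbhs.
  exists e => // _ /circle_ballP[s se <-]; apply: VU.
  rewrite -circle_piD; apply: eV; rewrite -ball_normE /=.
  by rewrite opprD addrA subrr sub0r normrN.
move=> [e e0 eU]; rewrite nbhsE.
(* The points of U that have a whole arc inside U; this set is open because halving the radius
   leaves room to move the centre. *)
exists [set c | exists2 e : R, 0 < e & forall d, circle_ball e d -> U (c + d)].
  split; last by exists e.
  rewrite /open /= /circle_open openE => r [e' e'0 e'U].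
  apply/nbhs_ballP; exists (e' / 2) => /=; first by rewrite divr_gt0.
  move=> s; rewrite -ball_normE /= => rs; exists (e' / 2); first by rewrite divr_gt0.
  move=> d dd.
  have -> : circle_pi s + d = circle_pi r + (circle_pi (s - r) + d).
    by rewrite addrA -circle_piD addrCA subrr addr0.
  apply: e'U; rewrite (_ : e' = e' / 2 + e' / 2); last by lra.
  by apply: circle_ballD => //; apply: circle_ball_pi; rewrite distrC.
move=> c' [e' e'0 e'U]; rewrite -[c']addr0; apply: e'U; exact: circle_ball0.
Qed.

Lemma cvg_circleP (T : Type) (F : set_system T) (FF : Filter F) (f : T -> circle R) c :
  f @ F --> c <-> forall e : R, 0 < e -> \forall x \near F, circle_ball e (f x - c).
Proof.
split=> [fc e e0|H U /nbhs_circleP[e e0 eU]].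
  apply: (fc [set d | circle_ball e (d - c)]); apply/nbhs_circleP.
  by exists e => // d; rewrite /= addrAC subrr add0r.
apply: filterS (H e e0) => x fxc.
by rewrite /preimage /= -[f x](subrK c) addrC; exact: eU.
Qed.

Lemma circle_hausdorff : hausdorff_space (circle R).
Proof.
move=> p q pq; apply/eqP; rewrite -subr_eq0; apply/eqP/circle_ball_eq0 => e e0.
have e20 : 0 < e / 2 by rewrite divr_gt0.
have [] := pq [set z | circle_ball (e / 2) (p - z)] [set z | circle_ball (e / 2) (z - q)].
- apply/nbhs_circleP; exists (e / 2) => // d /circle_ballN.
  by rewrite /= opprD addrA subrr sub0r.
- apply/nbhs_circleP; exists (e / 2) => // d.
  by rewrite /= addrAC subrr add0r.
move=> z [/= pz zq]; rewrite -[p](subrK z) -addrA (_ : e = e / 2 + e / 2); last by lra.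
exact: circle_ballD.
Qed.

Lemma circle_compact : compact [set: circle R].
Proof.
have -> : [set: circle R] = @circle_pi R @` `[0, 1].
  apply/seteqP; split=> // c _; have [r <-] := circle_pi_surj c.
  exists (r - (Num.floor r)%:~R).
    have := floor_le_tmp r; have := floorD1_gt r.
    by rewrite rmorphD /= in_itv/= => *; apply/andP; split; lra.
  by rewrite circle_piB (circle_pi_int (intr_int R _)) subr0.
apply: continuous_compact; last exact: segment_compact.
by apply: continuous_subspaceT; exact: circle_pi_continuous.
Qed.

Lemma continuous_circleD (T : topologicalType) (f g : T -> circle R) :
  continuous f -> continuous g -> continuous (f \+ g).
Proof.
move=> cf cg x; apply/cvg_circleP => e e0.
have e20 : 0 < e / 2 by rewrite divr_gt0.
have /cvg_circleP/(_ _ e20) fx := cf x.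
have /cvg_circleP/(_ _ e20) gx := cg x.
near=> y; rewrite /= opprD addrACA (_ : e = e / 2 + e / 2); last by lra.
by apply: circle_ballD; near: y.
Unshelve. all: by end_near. Qed.

Lemma continuous_circleN (T : topologicalType) (f : T -> circle R) :
  continuous f -> continuous (\- f).
Proof.
move=> cf x; apply/cvg_circleP => e e0.
have /cvg_circleP/(_ _ e0) fx := cf x.
near=> y; rewrite /= -opprD; apply: circle_ballN.
by near: y.
Unshelve. all: by end_near. Qed.

Lemma continuous_circleB (T : topologicalType) (f g : T -> circle R) :
  continuous f -> continuous g -> continuous (f \- g).
Proof. by move=> cf /continuous_circleN; exact: continuous_circleD. Qed.

End CircleTopology.

(** * Real lifts of circle-valued functions and their asymptotic slopes *)

Section RealLifts.
Variable R : realType.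
Implicit Types (f g : R -> R) (a : R).

(** P and its complement are both open, and the line is connected. *)
Lemma real_locally_constant (P : set R) :
  (forall s, \forall t \near s, P t <-> P s) -> forall s t, P s -> P t.
Proof.
move=> Ploc s t Ps.
have oP (Q : set R) : (forall s, \forall t \near s, Q t <-> Q s) -> open Q.
  by move=> Qloc; rewrite openE => u Qu; apply: filterS (Qloc u) => v ->.
have /connected_intervalP cR : is_interval [set: R] by [].
suff -> : P = setT by [].
apply: cR; first by exists s.
  by exists P; [exact: oP|rewrite setTI].
exists P; last by rewrite setTI.
rewrite -openC; apply: oP => u.
by apply: filterS (Ploc u) => v uv; rewrite /setC /= uv.
Qed.

Lemma continuous_int_constant f :
  continuous f -> (forall t, f t \is a Num.int) -> forall t, f t = f 0.
Proof.
move=> cf fi t.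
apply: (@real_locally_constant [set t | f t = f 0] _ 0) => //= s.
have /cvgrPdist_lt/(_ _ ltr01) := cf s; apply: filterS => u su.
suff -> : f u = f s by [].
apply/eqP; rewrite eq_sym -subr_eq0; apply: contraTT su => su.
by rewrite -leNgt; apply: norm_intr_ge1 => //; exact: rpredB.
Qed.

(** The bound 1/4 makes a pointwise choice of small representatives continuous: for nearby points,
    the difference of the representatives and a lift u of the difference of the values, with |u| <
    1/4, are congruent modulo 1 and less than 3/4 apart, hence equal. *)
Lemma circle_small_lift (Z : topologicalType) (d : Z -> circle R) (e : R) :
  e <= 4^-1 -> continuous d -> (forall z, circle_ball e (d z)) ->
  exists r : Z -> R,
    [/\ continuous r, forall z, `|r z| < e & forall z, circle_pi (r z) = d z].
Proof.
move=> e4 cd de.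
have /choice[r rP] : forall z, exists r, `|r| < e /\ circle_pi r = d z.
  by move=> z; have /circle_ballP[r re rd] := de z; exists r.
exists r; split=> [z|z|z]; [|exact: (rP z).1|exact: (rP z).2].
apply/cvgrPdist_lt => e' e'0.
have m0 : 0 < Num.min e' 4^-1 by rewrite lt_min e'0 invr_gt0 ltr0n.
have /cvg_circleP/(_ _ m0) := cd z; apply: filterS => y.
rewrite -(rP y).2 -(rP z).2 -circle_piB => /circle_ballP[u].
rewrite lt_min => /andP[ue' u4] /circle_pi_eq ui.
have [ry _] := rP y; have [rz _] := rP z.
suff u0 : u - (r y - r z) = 0.
  by rewrite distrC (_ : r y - r z = u) //; lra.
apply/eqP; apply: contraT => /(norm_intr_ge1 ui) u1.
have : `|u - (r y - r z)| <= `|u| + (`|r y| + `|r z|).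
  by rewrite (le_trans (ler_normB _ _))// lerD2l ler_normB.
by lra.
Qed.

Lemma circle_lift_unique f g :
  continuous f -> continuous g ->
  (forall t, circle_pi (f t) = circle_pi (g t)) ->
  forall t, f t - g t = f 0 - g 0.
Proof.
move=> cf cg fg; apply: (@continuous_int_constant (f \- g)) => t; first by apply: cvgB; [exact: cf|exact: cg].
exact/circle_pi_eq.
Qed.

Lemma slope_bounded_diff f g a (M : R) : (forall t, `|g t - f t| <= M) ->
  f t / t @[t --> +oo] --> a -> g t / t @[t --> +oo] --> a.
Proof.
move=> gf fa; rewrite -[a]addr0.
have -> : (fun t => g t / t) = (fun t => f t / t + (g t - f t) / t).
  by apply/funext => t; rewrite -mulrDl addrC subrK.
apply: cvgD => //; apply/cvgrPdist_lt => e e0.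
near=> t; rewrite sub0r normrN normrM normfV.
have t0 : 0 < t by near: t; exact: nbhs_pinfty_gt.
rewrite (gtr0_norm t0) ltr_pdivrMr// (le_lt_trans (gf t))//.
by rewrite mulrC -ltr_pdivrMr//; near: t; apply: nbhs_pinfty_gt; rewrite num_real.
Unshelve. all: by end_near. Qed.

Lemma slope_add_const (c : R) f a :
  f t / t @[t --> +oo] --> a -> (f t + c) / t @[t --> +oo] --> a.
Proof. by apply: (@slope_bounded_diff _ _ _ `|c|) => t; rewrite addrAC subrr add0r. Qed.

End RealLifts.

(** * Slopes along the suspension flow and their homotopy invariance *)

Section Suspension.
Variables (R : realType) (X : topologicalType) (T : homeomorphism X).
Local Notation S := (suspension R T).

Definition has_slope (phi : S -> circle R) (x : S) (a : R) :=
  exists2 f, is_lift phi x f & f t / t @[t --> +oo] --> a.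

Lemma susp_classE (n : int) (x : X) (s : R) :
  susp_class T (ziter T n x) (s - n%:~R) = susp_class T x s.
Proof. by apply/esym/eqmodP/asboolP; exists n. Qed.

Lemma susp_class_continuous :
  continuous (fun p : X * R => susp_class T p.1 p.2).
Proof.
have -> : (fun p : X * R => susp_class T p.1 p.2) = \pi_S%qT.
  by apply/funext => -[].
exact: pi_continuous.
Qed.

Lemma susp_class_surj01 (x : S) :
  exists y s, (s : R) \in `[0, 1] /\ x = susp_class T y s.
Proof.
have -> : x = susp_class T (repr x).1 (repr x).2.
  by rewrite /susp_class -surjective_pairing reprK.
move: (repr x) => [y s] /=.
exists (ziter T (Num.floor s) y), (s - (Num.floor s)%:~R); split; last first.
  by rewrite susp_classE.
have := floor_le_tmp s; have := floorD1_gt s.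
by rewrite rmorphD /= in_itv/= => *; apply/andP; split; lra.
Qed.

Lemma susp_compact : compact [set: X] -> compact [set: S].
Proof.
move=> cX.
have -> : [set: S] = (fun p : X * R => susp_class T p.1 p.2) @` (setT `*` `[0, 1]).
  apply/seteqP; split=> // x _; have [y [s [s01 ->]]] := susp_class_surj01 x.
  by exists (y, s).
apply: continuous_compact; last exact: compact_setX cX (@segment_compact _ _ _).
by apply: continuous_subspaceT; exact: susp_class_continuous.
Qed.

Lemma susp_flow_continuous (x : S) : continuous (fun t : R => susp_flow t x).
Proof.
have [y [s [_ ->]]] := susp_class_surj01 x.
rewrite (_ : (fun _ => _) = (fun p : X * R => susp_class T p.1 p.2) \o
   (fun t => (y, s + t))); last by apply/funext => t; rewrite susp_flowE.
move=> t; apply: continuous_comp; last exact: susp_class_continuous.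
apply: (@pair_continuous R X R (fun _ => y) (fun t => s + t)).
  by move=> u; exact: cvg_cst.
by move=> u; apply: cvgD; [exact: cvg_cst|exact: cvg_id].
Qed.

(** Two lifts along the same orbit differ by a constant, which is negligible after division by t. *)
Lemma has_slope_unique (phi : S -> circle R) x a b :
  has_slope phi x a -> has_slope phi x b -> a = b.
Proof.
move=> [f [cf fphi] fa] [g [cg gphi] gb].
have := slope_add_const (f 0 - g 0) gb.
have -> : (fun t => (g t + (f 0 - g 0)) / t) = (fun t => f t / t).
  apply/funext => t; rewrite -(@circle_lift_unique _ f g _ _ _ t) ?subrKC//.
  by move=> u; rewrite fphi gphi.
by move=> fb; apply: cvg_unique fa fb.
Qed.

(** Along an orbit, psi - phi has a lift bounded by 1/4; adding it to a lift of phi gives a lift of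
    psi at bounded distance. *)
Lemma has_slope_close (phi psi : S -> circle R) x a :
  continuous phi -> continuous psi ->
  (forall y, circle_ball 4^-1 (psi y - phi y)) ->
  has_slope phi x a -> has_slope psi x a.
Proof.
move=> cphi cpsi close [f [cf fphi] fa].
have cd : continuous ((psi \- phi) \o (fun t : R => susp_flow t x)).
  move=> t; apply: continuous_comp; first exact: susp_flow_continuous.
  exact: continuous_circleB.
have [r [cr r4 rd]] := circle_small_lift (lexx _) cd (fun _ => close _).
exists (fun t => f t + r t).
  split=> [t|t]; first by apply: cvgD; [exact: cf|exact: cr].
  by rewrite circle_piD fphi rd /= addrC subrK.
apply: (@slope_bounded_diff _ f _ a 4^-1) => // t.
by rewrite addrAC subrr add0r ltW.
Qed.

(** The set of times at which every orbit has slope a is locally constant: by compactness, maps at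
    nearby times are uniformly within 1/4 of each other. Connectedness of the line carries the slope
    from time 0 to time 1. *)
Lemma homotopic_has_slope (phi psi : continuousType S (circle R)) a :
  compact [set: X] -> homotopic R phi psi ->
  (forall x, has_slope phi x a) -> forall x, has_slope psi x a.
Proof.
move=> cX /asboolP[h [ch h0 h1]] phia x.
(* The homotopy is continuous only over [0, 1]; freezing it outside this interval gives a family
   indexed by all of R. *)
pose clamp (t : R) := Num.max 0 (Num.min 1 t).
have cclamp : continuous clamp.
  move=> t; apply: (@continuous_max R R (cst 0) (cst 1 \min id) t).
    exact: cvg_cst.
  by apply: (@continuous_min R R (cst 1) id t); [exact: cvg_cst|exact: cvg_id].
pose k (p : S * R) := h (p.1, clamp p.2).
have ck : continuous k.
  apply/continuous_subspace_setT.
  apply: (within_comp_continuous (s := fun p => (p.1, clamp p.2)) ch).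
    apply: pair_continuous => z; first exact: cvg_fst.
    by apply: continuous_comp; [exact: cvg_snd|exact: cclamp].
  move=> z _; split => //=; rewrite in_itv/= /clamp le_max lexx/=.
  by rewrite ge_max ler01 ge_min lexx.
have ck1 s : continuous (fun y => k (y, s)).
  move=> y; apply: (@continuous_comp _ _ _ (fun y => (y, s)) k); last exact: ck.
  by apply: (@pair_continuous S S R id (cst s)); [by move=> z U|exact: cst_continuous].
have kphi : (fun y => k (y, 0)) = phi.
  apply/funext => y; rewrite /k /clamp /= (_ : Num.max _ _ = 0) ?h0//.
  by rewrite (min_idPr _) ?ler01// maxxx.
have kpsi : (fun y => k (y, 1)) = psi.
  apply/funext => y; rewrite /k /clamp /= (_ : Num.max _ _ = 1) ?h1//.
  by rewrite minxx; apply/max_idPr; rewrite ler01.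
rewrite -kpsi; move: x.
pose P s := forall x, has_slope (fun y => k (y, s)) x a.
apply: (@real_locally_constant _ P _ 0); last by rewrite /P kphi.
move=> s.
have /compact_near_coveringP/(_ _ (nbhs s)
    (fun u y => circle_ball 4^-1 (k (y, u) - k (y, s)))) near_s := susp_compact cX.
apply: filterS (near_s _ _) => [u|y _].
  move=> us; split=> H x; apply: has_slope_close (H x) => // y.
    by rewrite -opprB; apply: circle_ballN; exact: us.
  exact: us.
have c0 : continuous (fun q : S * R => k q - k (q.1, s)).
  apply: continuous_circleB ck _ => q.
  by apply: (@continuous_comp _ _ _ fst (fun y => k (y, s))); [exact: cvg_fst|exact: ck1].
have /cvg_circleP/(_ 4^-1) := c0 (y, s).
by rewrite /= subrr invr_gt0 ltr0n => /(_ isT); apply: filterS => -[z u] /=; rewrite subr0.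
Qed.

End Suspension.

(** * Extension of continuous maps from a dense subset *)

Section DenseExtension.
Implicit Types X Y : topologicalType.

Lemma dense_nbhs X (A U : set X) (x : X) : dense A -> nbhs x U -> U `&` A !=set0.
Proof.
rewrite nbhsE => dA [V [oV Vx] VU].
have [y [Vy Ay]] := dA V (ex_intro _ x Vx) oV.
by exists y; split => //; exact: VU.
Qed.

Lemma dense_continuous_eq X Y (A : set X) (f g : X -> Y) :
  hausdorff_space Y -> dense A -> continuous f -> continuous g ->
  (forall x, A x -> f x = g x) -> f =1 g.
Proof.
move=> hY dA cf cg fg x; apply: hY => U V Ux Vx.
have fgUV : nbhs x (f @^-1` U `&` g @^-1` V).
  by apply: filterI; [exact: cf|exact: cg].
have [y [[Uy Vy] Ay]] := dense_nbhs dA fgUV.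
by exists (f y); split => //; rewrite fg.
Qed.

Lemma dense_range_prod (D E : Type) X Y (i : D -> X) (j : E -> Y) :
  dense (range i) -> dense (range j) ->
  dense (range (fun p : D * E => (i p.1, j p.2))).
Proof.
move=> di dj O [[x y] Oxy] oO.
have [[U V] /= [Ux Vy] UVO] : nbhs (x, y) O by exact: open_nbhs_nbhs.
have [_ [/[swap] [[d _ <-]] Ud]] := dense_nbhs di Ux.
have [_ [/[swap] [[e _ <-]] Ve]] := dense_nbhs dj Vy.
by exists (i d, j e); split; [exact: (UVO (i d, j e))|exists (d, e)].
Qed.

(** The value f x is a limit of g at x. Near x, f takes values in the closure of any neighbourhood
    of f x that contains the nearby values of g; regularity makes this closure small. *)
Lemma dense_extension (D : Type) X Y (i : D -> X) (g : D -> Y) :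
  regular_space Y -> hausdorff_space Y -> dense (range i) ->
  (forall x : X, exists y : Y, forall W, nbhs y W ->
     exists2 U, nbhs x U & forall d, U (i d) -> W (g d)) ->
  exists2 f : X -> Y, continuous f & forall d, f (i d) = g d.
Proof.
move=> rY hY di /choice[f fP]; exists f => [x W /rY[W' W'x W'W]|d]; last first.
  apply: hY => A B Ad Bd; exists (g d); split; last exact: nbhs_singleton.
  by have [U Ud] := fP _ _ Ad; apply; exact: nbhs_singleton.
have [U Ux UW'] := fP _ _ W'x.
apply: filterS (nbhs_interior Ux) => y Uy.
apply: W'W => N /fP[V Vy VN].
have [_ [/[swap] [[d _ <-]] [Ud Vd]]] := dense_nbhs di (filterI Uy Vy).
by exists (g d); split; [exact: UW'|exact: VN].
Qed.

(* The last hypothesis is the Cauchy condition for [g] along the traces of the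
   neighbourhoods of [x], stated without a uniform structure on [Y]. *)
Lemma dense_extension_compact (D : Type) X Y (i : D -> X) (g : D -> Y) :
  hausdorff_space Y -> compact [set: Y] -> dense (range i) ->
  (forall (x : X) (y : Y) W, nbhs y W -> exists2 U, nbhs x U &
     exists2 V, nbhs y V &
     forall d d', U (i d) -> U (i d') -> V (g d) -> W (g d')) ->
  exists2 f : X -> Y, continuous f & forall d, f (i d) = g d.
Proof.
move=> hY cY di g_cauchy; apply: dense_extension => // [y|x].
  by apply: compact_regular hY cY _; exact: filterT.
(* The traces of the neighbourhoods of x, pushed forward by g. Compactness gives this filter a
   cluster point, and the Cauchy condition turns it into a limit. *)
pose F := filter_from (nbhs x) (fun U => g @` (i @^-1` U)).
have FF : ProperFilter F.
  apply: filter_from_proper => [|U xU].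
    apply: filter_from_filter => [|U V xU xV]; first by exists setT; exact: filterT.
    exists (U `&` V); first exact: filterI.
    by move=> _ [d [Ud Vd] <-]; split; exists d.
  have [_ [/[swap] [[d _ <-]] Ud]] := dense_nbhs di xU.
  by exists (g d), d.
have [y [_ Fy]] : [set: Y] `&` cluster F !=set0.
  by apply: cY; exists setT => //; exact: filterT.
exists y => W /(g_cauchy x)[U xU [V yV UVW]].
exists U => // d Ud.
have [|_ [[d' Ud' <-] Vd']] := Fy (g @` (i @^-1` U)) V _ yV; first by exists U.
exact: UVW Ud' Ud Vd'.
Qed.

End DenseExtension.

(** * Values of the Schwartzman homomorphism as slopes of single orbits *)

Section SchwartzmanValue.
Variables (R : realType) (X : topologicalType) (T : homeomorphism X).
Variables (x0 : X) (mu : probability (borel x0) R).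
Local Notation S := (suspension R T).

Lemma susp_measure_setT : susp_measure (T := T) mu setT = 1%E.
Proof.
rewrite /susp_measure.
under eq_integral => s _.
  under eq_integral => x _ do rewrite indicE in_setT.
  rewrite (integral_cst _ _ 1%E)//= mul1e probability_setT.
  over.
by rewrite (integral_cst _ _ 1%E)//= mul1e lebesgue_measure_itv/= lte_fin ltr01 oppr0 adde0.
Qed.

(** Since the total mass is 1, the whole space is not negligible. This passes from almost every
    orbit to one orbit. *)
Lemma susp_ae_exists (P : set S) :
  (\forall x \ae susp_measure (T := T) mu, P x) -> exists x, P x.
Proof.
move=> [A [_ A0 PA]]; apply: contrapT => nP.
have AT : A = setT.
  by apply/seteqP; split=> // x _; apply: PA => Px; apply: nP; exists x.
by move: A0; rewrite AT susp_measure_setT => /eqP; rewrite onee_eq0.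
Qed.

(** The constant a qualifies, with empty exceptional set, so [xget] does not fall back on its
    default; whichever b it selects agrees with a on some orbit. *)
Lemma schwartzman_eq (c : Csharp R T) a :
  (forall phi : continuousType S (circle R),
     \pi_(homotopy_class R S (circle R))%qT phi = c ->
     forall x, has_slope phi x a) ->
  schwartzman mu c = a.
Proof.
move=> ca; rewrite /schwartzman; case: xgetP => [b _ Pb|/(_ a)[]]; last first.
  move=> phi phic; exists set0; split => //; last first.
    by move=> x; apply; exact: ca.
  rewrite /susp_measure integral0_eq// => s _.
  by rewrite integral0_eq// => x _; rewrite indic0.
have [x xb] := susp_ae_exists (Pb _ (reprK c)).
exact: has_slope_unique xb (ca _ (reprK c) x).
Qed.

(** The first alternative covers the default value 0 of [xget], taken when no constant qualifies. *)
Lemma schwartzman_cases (c : Csharp R T) : schwartzman mu c = 0 \/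
  exists (phi : continuousType S (circle R)) x, has_slope phi x (schwartzman mu c).
Proof.
rewrite {1}/schwartzman; case: xgetP => [a ac Pa|]; last by left.
right; exists (repr c).
by rewrite /schwartzman -ac; exact: susp_ae_exists (Pa _ (reprK c)).
Qed.

End SchwartzmanValue.

(** * Slopes and almost-return times *)

(** By continuity the increments over tau stay within e of one integer N, so k of them sum to k N up
    to k e. For large k the sum is also a k tau up to k e; dividing by k gives the bound 2 e. *)
Lemma circle_slope_return (R : realType) (f : R -> R) (a tau e : R) :
  continuous f -> f t / t @[t --> +oo] --> a ->
  0 < e -> e <= 4^-1 ->
  (forall t, circle_ball e (circle_pi (f (t + tau) - f t))) ->
  circle_ball (2 * e) (circle_pi (a * tau)).
Proof.
(* The slope is a limit at +oo, so tau should be positive; a negative tau is replaced by its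
   opposite after translating t. *)
move=> cf fa e0 e4; wlog tau0 : tau / 0 < tau => [wl fe|fe].
  have [tau0|tau0|<-] := ltgtP 0 tau; [exact: (wl tau)| |]; last first.
    by rewrite mulr0 circle_pi0; apply: circle_ball0; lra.
  rewrite -[a * tau]opprK circle_piN -mulrN; apply: circle_ballN.
  apply: wl => [|t]; first by rewrite oppr_gt0.
  rewrite -opprB circle_piN; apply: circle_ballN.
  by have := fe (t - tau); rewrite subrK.
have cf_tau : continuous (fun t => f (t + tau) - f t).
  move=> t; apply: cvgB; last exact: cf.
  apply: (@continuous_comp _ _ _ (fun t => t + tau) f); last exact: cf.
  by apply: cvgD; [exact: cvg_id|exact: cvg_cst].
have cd : continuous (@circle_pi R \o (fun t => f (t + tau) - f t)).
  by move=> t; apply: continuous_comp; [exact: cf_tau|exact: circle_pi_continuous].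
have [r [cr re rd]] := circle_small_lift e4 cd fe.
(* The increment and its small representative r lift the same map, so their difference is constant;
   its value at 0 is the integer N. *)
have := @circle_lift_unique _ _ _ cf_tau cr (fun t => esym (rd t)).
have : f (0 + tau) - f 0 - r 0 \is a Num.int by apply/circle_pi_eq; rewrite rd.
move=> /intrP[N ->] fN.
have fk (k : nat) : `|f (k%:R * tau) - f 0 - k%:R * N%:~R| <= k%:R * e.
  elim: k => [|k IH]; first by rewrite !mul0r subrr subr0 normr0.
  have fkS : f (k.+1%:R * tau) - f 0 - k.+1%:R * N%:~R =
      (f (k%:R * tau) - f 0 - k%:R * N%:~R) + r (k%:R * tau).
    have := fN (k%:R * tau); rewrite -natr1 !mulrDl !mul1r => /= fNk.
    by lra.
  rewrite fkS (le_trans (ler_normD _ _))// -natr1 mulrDl mul1r lerD//.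
  exact: ltW (re _).
have et0 : 0 < e / tau by rewrite divr_gt0.
(* The tolerance e / tau becomes k e once multiplied by the elapsed time k tau. *)
have /cvgrPdist_lt/(_ _ et0)[M [_ Mfa]] := slope_add_const (- f 0) fa.
pose k := (Num.bound `|M / tau|).+1.
have k0 : 0 < (k%:R : R) by rewrite ltr0n.
have Mk : M < k%:R * tau.
  rewrite -ltr_pdivrMr// (le_lt_trans (ler_norm _))//.
  apply: lt_trans (archi_boundP (normr_ge0 _)) _.
  by rewrite ltr_nat.
have := Mfa _ Mk; have := fk k.
have kt0 : 0 < k%:R * tau by rewrite mulr_gt0.
set F := f _ - f 0 => F1 F2.
rewrite -[a * tau](subrK N%:~R) circle_piD (circle_pi_int (intr_int R _)) addr0.
apply: circle_ball_pi.
have {}F2 : `|a * (k%:R * tau) - F| < k%:R * e.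
  have -> : a * (k%:R * tau) - F = (a - F / (k%:R * tau)) * (k%:R * tau).
    by rewrite mulrBl divfK// gt_eqF.
  rewrite normrM (gtr0_norm kt0) -ltr_pdivlMr//.
  by rewrite (_ : k%:R * e / _ = e / tau)// -mulf_div divff ?mul1r// gt_eqF.
rewrite -(ltr_pM2l k0) -{1}(gtr0_norm k0) -normrM.
have -> : k%:R * (a * tau - N%:~R) = (a * (k%:R * tau) - F) + (F - k%:R * N%:~R).
  by ring.
rewrite (le_lt_trans (ler_normD _ _))//.
by rewrite (_ : k%:R * (2 * e) = k%:R * e + k%:R * e) ?ltr_leD//; ring.
Qed.

(** * Characters and slopes for a compact space with a dense orbit and a continuous law *)

Section Monothetic.
Variables (R : realType) (G : topologicalType) (T : homeomorphism G).
Variables (mul : G -> G -> G) (pt : int -> G).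
Hypothesis cG : compact [set: G].
Hypothesis dense_pt : dense (range pt).
Hypothesis mul_continuous : continuous (fun p : G * G => mul p.1 p.2).
Hypothesis mul_ptE : forall n x, mul (pt n) x = ziter T n x.
Hypothesis ziter_pt : forall m n, ziter T m (pt n) = pt (m + n).
(** No inverse is assumed on G; this supplies, on the orbit only, what continuity of subtraction at
    (x, x) would give. *)
Hypothesis pt_near : forall (x : G) (U : set G), nbhs (pt 0) U ->
  exists2 W, nbhs x W & forall m n, W (pt m) -> W (pt n) -> U (pt (m - n)).
Local Notation S := (suspension R T).

Lemma dual_group_pt (chi : G -> circle R) n :
  dual_group R mul chi -> chi (pt n) = chi (pt 1) *~ n.
Proof.
move=> [_ chiM].
have chiD m k : chi (pt (m + k)) = chi (pt m) + chi (pt k).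
  by rewrite -chiM mul_ptE ziter_pt.
elim/int_rect: n => [|n IH|n IH].
- by apply: (@addrI _ (chi (pt 0))); rewrite -chiD !addr0.
- by rewrite -addn1 PoszD chiD IH mulrzDr.
- rewrite -addn1 PoszD opprD mulrzBr -IH.
  by apply: (@addIr _ (chi (pt 1))); rewrite -chiD !subrK.
Qed.

Lemma dual_group_schwartzman (chi : G -> circle R) (t : R) (x0 : G)
    (mu : probability (borel x0) R) :
  dual_group R mul chi -> circle_pi t = chi (pt 1) ->
  schwartzman_range T mu t.
Proof.
move=> chiG tchi; have [cchi chiM] := chiG.
pose Phi (p : G * R) := chi p.1 + circle_pi (t * p.2).
have cPhi : continuous Phi.
  apply: continuous_circleD.
    by move=> p; apply: continuous_comp; [exact: cvg_fst|exact: cchi].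
  move=> p; apply: (@continuous_comp _ _ _ (fun p => t * p.2)).
    by apply: cvgM; [exact: cvg_cst|exact: cvg_snd].
  exact: circle_pi_continuous.
(* Phi respects the suspension relation: the factor chi (pt n) = pi (t n) gained in the first
   coordinate is lost in the second. *)
have PhiE n x s : Phi (ziter T n x, s - n%:~R) = Phi (x, s).
  rewrite /Phi /= -mul_ptE chiM dual_group_pt// -tchi -circle_piMz.
  by rewrite addrAC -circle_piD addrC mulrBr subrKC.
have rcPhi : continuous (Phi \o repr : S -> circle R).
  apply: repr_comp_continuous cPhi _ => p q /eqP/eqmodP/asboolP[n ->].
  by apply/eqP; rewrite PhiE; case: p.
pose phi : continuousType S (circle R) :=
  HB.pack (Phi \o repr : S -> circle R) (isContinuous.Build _ _ _ rcPhi).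
have phiE x s : phi (susp_class T x s) = Phi (x, s).
  rewrite /= /susp_class; set p := repr _.
  have : p = (x, s) %[mod {eq_quot susp_equiv R T}]%qT by rewrite /p reprK.
  move=> /esym/eqmodP /asboolP[n ->]; exact: PhiE.
exists (\pi_(homotopy_class R S (circle R))%qT phi) => //.
apply: schwartzman_eq => psi /esym/eqmodP phipsi.
apply: homotopic_has_slope cG phipsi _ => x.
have [y [s [_ ->]]] := susp_class_surj01 x.
have [r rchi] := circle_pi_surj (chi y).
exists (fun u => t * u + (r + t * s)).
  split=> [u|u].
    by apply: cvgD; [apply: cvgM; [exact: cvg_cst|exact: cvg_id]|exact: cvg_cst].
  by rewrite susp_flowE phiE /Phi /= -rchi -circle_piD; congr circle_pi; ring.
apply: slope_add_const; apply: cvg_near_cst; near=> u.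
by rewrite mulfK// gt_eqF//; near: u; exact: nbhs_pinfty_gt.
Unshelve. all: by end_near. Qed.

(** Flowing [y, s] for time n gives [pt n y, s], which is close to [y, s] when pt n is close to pt
    0, uniformly by compactness of G x [0, 1]. Integers enter through the equation u = pt n because
    the neighbourhood lives in G and [pt] may fail to be injective. *)
Lemma susp_flow_return (phi : S -> circle R) (e : R) : continuous phi -> 0 < e ->
  \forall u \near pt 0, forall n x, u = pt n ->
    circle_ball e (phi (susp_flow n%:~R x) - phi x).
Proof.
move=> cphi e0.
pose F (q : G * (G * R)) := phi (susp_class T (mul q.1 q.2.1) q.2.2).
have cF : continuous F.
  move=> q; apply: continuous_comp; last exact: cphi.
  apply: (@continuous_comp _ _ _ (fun q : G * (G * R) => (mul q.1 q.2.1, q.2.2))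
    (fun p => susp_class T p.1 p.2)); last exact: susp_class_continuous.
  apply: pair_continuous => z; last by apply: continuous_comp; exact: cvg_snd.
  apply: (@continuous_comp _ _ _ (fun q : G * (G * R) => (q.1, q.2.1))
    (fun p => mul p.1 p.2)); last exact: mul_continuous.
  apply: pair_continuous => w; first exact: cvg_fst.
  by apply: continuous_comp; [exact: cvg_snd|exact: cvg_fst].
have cFF : continuous (fun q => F q - F (pt 0, q.2)).
  apply: (continuous_circleB cF) => q.
  apply: (@continuous_comp _ _ _ (fun q : G * (G * R) => (pt 0, q.2)) F); last exact: cF.
  by apply: pair_continuous; [exact: cst_continuous|move=> w; exact: cvg_snd].
have cK := compact_setX cG (@segment_compact R 0 1).
have /compact_near_coveringP/(_ _ (nbhs (pt 0))
    (fun u p => circle_ball e (F (u, p) - F (pt 0, p)))) near_e := cK.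
apply: filterS (near_e _ _) => [u ue n x un|[y s] _].
  have [y [s [s01 ->]]] := susp_class_surj01 x.
  have := ue (y, s) (conj I s01); rewrite /F /= un !mul_ptE /=.
  by rewrite susp_flowE -(susp_classE T n y (s + n%:~R)) addrK.
have /cvg_circleP/(_ _ e0) := cFF (pt 0, (y, s)).
rewrite /= subrr => -[[U V] /= [U0 Vys] UVe].
exists (V, U) => //= -[p u] [/= Vp Uu].
by have := UVe (u, p) (conj Uu Vp); rewrite /= subr0.
Qed.

Lemma has_slope_dual_group (phi : S -> circle R) x a :
  continuous phi -> has_slope phi x a ->
  exists2 chi, dual_group R mul chi & circle_pi a = chi (pt 1).
Proof.
move=> cphi [f [cf fphi] fa].
pose g (n : int) : circle R := circle_pi (a * n%:~R).
have g_near (e : R) : 0 < e ->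
    exists2 U, nbhs (pt 0) U & forall n, U (pt n) -> circle_ball e (g n).
  (* The bound 1/4 is required by [circle_slope_return], and e / 2 compensates its factor 2. *)
  move=> e0; pose e' := Num.min (e / 2) 4^-1.
  have e'0 : 0 < e' by rewrite lt_min divr_gt0//= invr_gt0 ltr0n.
  have e'e : 2 * e' <= e.
    by rewrite mulrC -ler_pdivlMr// ge_min lexx.
  exists [set u | forall n x, u = pt n ->
    circle_ball e' (phi (susp_flow n%:~R x) - phi x)].
    exact: susp_flow_return.
  move=> n nU; apply: (circle_ball_le e'e).
  apply: (circle_slope_return cf fa e'0) => [|t]; first by rewrite ge_min lexx orbT.
  rewrite circle_piB !fphi.
  have := nU n (susp_flow t x) erefl.
  have [y [s [_ ->]]] := susp_class_surj01 x.
  by rewrite !susp_flowE addrA.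
have gB m n : g (m - n) = g m - g n by rewrite /g rmorphB mulrBr circle_piB.
have g_cauchy (y : G) (c : circle R) W : nbhs c W -> exists2 U, nbhs y U &
    exists2 V, nbhs c V &
    forall m n, U (pt m) -> U (pt n) -> V (g m) -> W (g n).
  move=> /nbhs_circleP[e e0 eW].
  have e20 : 0 < e / 2 by rewrite divr_gt0.
  have [U0 nU0 U0g] := g_near _ e20.
  have [U yU UU0] := pt_near y nU0.
  exists U => //; exists [set d | circle_ball (e / 2) (d - c)].
    by apply/nbhs_circleP; exists (e / 2) => // d; rewrite /= addrAC subrr add0r.
  move=> m n Um Un /= mc.
  rewrite -[g n](subrK c) addrC; apply: eW.
  rewrite -[g n](subrK (g m)) -addrA -gB (_ : e = e / 2 + e / 2); last by lra.
  by apply: circle_ballD => //; apply: U0g; exact: UU0.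
have [chi cchi chig] := dense_extension_compact (@circle_hausdorff R)
  (@circle_compact R) dense_pt g_cauchy.
exists chi; last by rewrite chig /g mulr1.
split=> // y z.
(* Additivity holds on pairs of orbit points, which are dense in G x G. *)
apply: (@dense_continuous_eq _ _ _ (fun p : G * G => chi (mul p.1 p.2))
  (fun p => chi p.1 + chi p.2) _ (dense_range_prod dense_pt dense_pt) _ _ _ (y, z)).
- exact: circle_hausdorff.
- by move=> p; apply: (@continuous_comp _ _ _ (fun p : G * G => mul p.1 p.2));
    [exact: mul_continuous|exact: cchi].
- apply: continuous_circleD => p; apply: continuous_comp; try exact: cchi.
    exact: cvg_fst.
  exact: cvg_snd.
move=> _ [[m n] _ <-] /=; rewrite mul_ptE ziter_pt !chig.
by rewrite /g rmorphD mulrDr circle_piD.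
Qed.

Lemma schwartzman_range_dual_group (x0 : G) (mu : probability (borel x0) R) :
  schwartzman_range T mu =
  [set t | exists2 chi, dual_group R mul chi & circle_pi t = chi (pt 1)].
Proof.
apply/seteqP; split=> [_ [c _ <-]|t [chi chiG tchi]]; last first.
  exact: dual_group_schwartzman chiG tchi.
(* The default value 0 is realised by the trivial character. *)
have [->|[phi [x]]] := schwartzman_cases mu c.
  exists (fun=> 0); last exact: circle_pi0.
  by split=> [|y z]; [exact: cst_continuous|rewrite addr0].
by apply: has_slope_dual_group; exact: cts_fun.
Qed.

End Monothetic.

(** * The hull of an almost-periodic sequence *)

Section Hull.
Variables (R : realType) (V : int -> R).

Lemma nbhs_uniform_ballP (f : {uniform int -> R}) (P : set {uniform int -> R}) :
  nbhs f P <->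
  exists2 e : R, 0 < e & forall h, (forall n, `|f n - h n| < e) -> P h.
Proof.
split=> [/uniform_nbhs[E [entE EP]]|[e e0 eP]].
  have [e /= e0 eE] : exists2 e : R, 0 < e & [set xy | ball xy.1 e xy.2] `<=` E.
    by move: entE; rewrite -entourage_ballE => -[e e0 eE]; exists e.
  exists e => // h fh; apply: EP => n _; apply: eE.
  by rewrite /= -ball_normE; exact: fh.
apply/uniform_nbhs; exists [set xy | ball xy.1 e xy.2]; split.
  by rewrite -entourage_ballE; exists e.
by move=> h fh; apply: eP => n; have := fh n I; rewrite /= -ball_normE.
Qed.

Lemma nbhs_hullP (f : hull V) (U : set (hull V)) : nbhs f U <->
  exists2 e : R, 0 < e &
    forall g : hull V, (forall n, `|val f n - val g n| < e) -> U g.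
Proof.
split=> [[_ [[A oA <-] Af AU]]|[e e0 eU]].
  have /nbhs_uniform_ballP[e e0 eA] : nbhs (val f : {uniform int -> R}) A.
    exact: open_nbhs_nbhs.
  by exists e => // g fg; apply: AU; exact: eA.
have : nbhs (val f : {uniform int -> R}) [set h | forall n, `|val f n - h n| < e].
  by apply/nbhs_uniform_ballP; exists e.
move=> nf; pose N := [set g : hull V | forall n, `|val f n - val g n| < e].
have fN : nbhs f N.
  exact: (@initial_continuous _ _ (set_val : hull V -> {uniform int -> R}) f _ nf).
by apply: filterS fN => g; exact: eU.
Qed.

Lemma hull_hausdorff : hausdorff_space (hull V).
Proof.
move=> p q pq; apply: val_inj; apply/funext => n.
apply/eqP; rewrite -subr_eq0 -normr_le0; apply/ler_addgt0Pl => e e0; rewrite addr0.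
have e20 : 0 < e / 2 by rewrite divr_gt0.
have [] := pq [set g | forall n, `|val p n - val g n| < e / 2]
              [set g | forall n, `|val q n - val g n| < e / 2].
- by apply/nbhs_hullP; exists (e / 2).
- by apply/nbhs_hullP; exists (e / 2).
move=> g [/(_ n) pg /(_ n) qg].
by rewrite (le_trans (ler_distD (val g n) _ _))// [`|_ - val q n|]distrC; lra.
Qed.

Lemma hull_compact : compact (hull V) -> compact [set: hull V].
Proof.
move=> cV F FF FT.
have valV (f : hull V) : hull V (val f) by exact: set_mem (valP f).
have [|p [Vp Fp]] := cV ((set_val : hull V -> {uniform int -> R}) @ F) _.
  by apply: (@filterS _ F _ setT) => // f _; exact: valV.
exists (exist _ p (mem_set Vp)); split => // A B FA /nbhs_hullP[e e0 eB].
have [||_ [[f Af <-] pf]] := Fp (set_val @` A) [set h | forall n, `|p n - h n| < e].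
- by apply: (@filterS _ F _ A) => // f Af; exists f.
- by apply/nbhs_uniform_ballP; exists e.
by exists f; split => //; exact: eB.
Qed.

Lemma hull_pt_dense : dense (range (hull_pt V)).
Proof.
move=> O [f Of] oO.
have /nbhs_hullP[e e0 eO] : nbhs f O by exact: open_nbhs_nbhs.
have [_ [[k _ <-] fk]] : orb V `&` [set h | forall n, `|val f n - h n| < e] !=set0.
  by apply: (set_mem (valP f)); apply/nbhs_uniform_ballP; exists e.
by exists (hull_pt V k); split; [exact: eO|exists k].
Qed.

(** Shifts are isometries: both estimates, read at j - n, compare V (j + m - n) and V j with the
    same value of x. *)
Lemma hull_pt_near (x : hull V) (U : set (hull V)) : nbhs (hull_pt V 0) U ->
  exists2 W, nbhs x W &
    forall m n, W (hull_pt V m) -> W (hull_pt V n) -> U (hull_pt V (m - n)).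
Proof.
move=> /nbhs_hullP[e e0 eU].
have e20 : 0 < e / 2 by rewrite divr_gt0.
exists [set g : hull V | forall n, `|val x n - val g n| < e / 2].
  by apply/nbhs_hullP; exists (e / 2).
move=> m n /= xm xn; apply: eU => j /=.
have := xm (j - n); have := xn (j - n); rewrite /= /Defs.shift subrK addr0.
rewrite -addrA [- n + m]addrC.
move: (val x _) (V _) (V _) => a c b.
rewrite !ltr_norml => /andP[? ?] /andP[? ?].
by apply/andP; split; lra.
Qed.

Lemma is_hull_mul_exists : compact (hull V) -> exists m, @is_hull_mul R V m.
Proof.
move=> cV.
have [f cf fE] : exists2 f : hull V * hull V -> hull V, continuous f &
    forall p : int * int, f (hull_pt V p.1, hull_pt V p.2) = hull_pt V (p.1 + p.2).
  apply: (@dense_extension_compact _ _ _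
    (fun p : int * int => (hull_pt V p.1, hull_pt V p.2))
    (fun p => hull_pt V (p.1 + p.2))) => [| | |[x y] z W].
  - exact: hull_hausdorff.
  - exact: hull_compact.
  - exact: dense_range_prod hull_pt_dense hull_pt_dense.
  move=> /nbhs_hullP[e e0 eW].
  (* Five errors of e / 8 occur: from z to S^(k+l) V, then to S^(k'+l) V through x at n + l, then to
     S^(k'+l') V through y at n + k'. *)
  have e80 : 0 < e / 8 by rewrite divr_gt0.
  pose B (u : hull V) := [set g : hull V | forall n, `|val u n - val g n| < e / 8].
  have nB u : nbhs u (B u) by apply/nbhs_hullP; exists (e / 8).
  exists (B x `*` B y); first by exists (B x, B y).
  exists (B z) => //= -[k l] [k' l'] /= [xk yl] [xk' yl'] zkl.
  apply: eW => n /=.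
  have /= := xk (n + l); have /= := xk' (n + l).
  have /= := yl (n + k'); have /= := yl' (n + k').
  have /= := zkl n.
  rewrite /Defs.shift [n + (k + l)]addrA [n + k + l]addrAC [n + (k' + l')]addrA.
  rewrite [n + l + k']addrAC.
  move: (val x _) (val y _) (val z _) (V (n + l + k)) (V (n + k' + l))
    (V (n + k' + l')) => a b c d1 d2 d3.
  rewrite !ltr_norml => /andP[? ?] /andP[? ?] /andP[? ?] /andP[? ?] /andP[? ?].
  by apply/andP; split; lra.
exists (fun x y => f (x, y)); split => [p|k l]; last exact: (fE (k, l)).
by rewrite (_ : (fun p => _) = f)//; apply/funext => -[].
Qed.

Lemma ziter_hull_shift n (f : hull V) : ziter (hull_shift V) n f = hull_shiftz n f.
Proof.
have shiftzD k l : hull_shiftz k (hull_shiftz l f) = hull_shiftz (k + l) f.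
  by apply: val_inj; exact: shiftD.
elim/int_rect: n => [|n IH|n IH].
- by apply: val_inj; apply/funext => j; rewrite /= /Defs.shift addr0.
- by rewrite -addn1 PoszD ziterS IH [LHS]shiftzD addrC.
- by rewrite -addn1 PoszD opprD ziterP IH [LHS]shiftzD addrC.
Qed.

Lemma hull_schwartzman_range (x0 : hull V) (mu : probability (borel x0) R) :
  almost_periodic V ->
  schwartzman_range (hull_shift V) mu = frequency_module V.
Proof.
move=> [_ cV].
have [cM ptM] : is_hull_mul (@hull_mul R V).
  by apply: (@xgetPex _ _ (@is_hull_mul R V)); exact: is_hull_mul_exists.
have ziter_pt m n : ziter (hull_shift V) m (hull_pt V n) = hull_pt V (m + n).
  by rewrite ziter_hull_shift; apply: val_inj; exact: shiftD.
apply: (@schwartzman_range_dual_group _ _ _ (@hull_mul R V) (hull_pt V)) => //.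
- exact: hull_compact.
- exact: hull_pt_dense.
(* Multiplication by S^n V and the shift by n are continuous and agree on the dense orbit. *)
- move=> n x; rewrite ziter_hull_shift.
  apply: (@dense_continuous_eq _ _ _ (hull_mul (hull_pt V n)) (hull_shiftz n)
    hull_hausdorff hull_pt_dense).
  + move=> y; apply: (@continuous_comp _ _ _ (fun y => (hull_pt V n, y))
      (fun p => hull_mul p.1 p.2)); last exact: cM.
    by apply: pair_continuous; [exact: cst_continuous|move=> w; exact: cvg_id].
  + exact: hull_shiftz_continuous.
  + by move=> _ [k _ <-]; rewrite ptM -ziter_hull_shift ziter_pt.
- exact: hull_pt_near.
Qed.

End Hull.

(** * Rotations of compact groups, and the conclusion *)

Lemma rotation_schwartzman_range (R : realType) (Omega : topologicalZmodType)
    (alpha x0 : Omega) (mu : probability (borel x0) R) :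
  compact [set: Omega] -> dense (range (fun n : int => alpha *~ n)) ->
  schwartzman_range (rotation alpha) mu =
  @circle_pi R @^-1` [set chi alpha | chi in dual_group R +%R].
Proof.
move=> cO dO.
have ziterE n x : ziter (rotation alpha) n x = alpha *~ n + x.
  elim/int_rect: n => [|n IH|n IH]; first by rewrite mulr0z add0r.
    by rewrite -addn1 PoszD ziterS IH mulrzDr /= addrA [alpha + _]addrC.
  by rewrite -addn1 PoszD opprD ziterP IH mulrzBr /= addrA [- alpha + _]addrC.
rewrite (@schwartzman_range_dual_group _ _ _ +%R (fun n => alpha *~ n)) //.
- apply/seteqP; split=> [t [chi chiG tchi]|t [chi chiG tchi]]; by exists chi.
- exact: add_continuous.
- by move=> m n; rewrite ziterE mulrzDr.
(* The near-return condition comes from continuity of subtraction at (x, x). *)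
- move=> x U U0.
  have cB : continuous (fun p : Omega * Omega => p.1 - p.2).
    exact: sub_continuous.
  have := cB (x, x) U; rewrite /= subrr => /(_ U0)[[A B] /= [xA xB] ABU].
  exists (A `&` B); first exact: filterI.
  by move=> m n [Am _] [_ Bn]; rewrite mulrzBr; exact: (ABU (_, _) (conj Am Bn)).
Qed.

Theorem theorem6p12 (R : realType) :
  (forall (Omega : topologicalZmodType) (alpha : Omega),
     compact [set: Omega] -> metrizable R Omega ->
     dense (range (fun n : int => alpha *~ n)) ->
     forall (x0 : Omega) (mu : probability (borel x0) R),
       ergodic (rotation alpha) mu ->
       schwartzman_range (rotation alpha) mu =
       @circle_pi R @^-1` [set chi alpha | chi in dual_group R +%R])
  /\
  (forall V : int -> R, almost_periodic V ->
     forall (x0 : hull V) (mu : probability (borel x0) R),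
       ergodic (hull_shift V) mu ->
       schwartzman_range (hull_shift V) mu = frequency_module V).
Proof.
split.
  by move=> O alpha cO _ dO x0 mu _; exact: rotation_schwartzman_range.
by move=> V apV x0 mu _; exact: hull_schwartzman_range.
Qed.
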